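(* Let $\mu$ be a Borel measure, $\mathscr{D}$ the cubes for the metric space $\Sigma=\operatorname{supp}\mu$ with constants $c_{0}$ and $c_{1}$, and $E\subseteq\Delta_{0}\in\mathscr{D}$ a Borel set. Let $M_{0}>1$ and suppose that, for some $C_\mu>1$, $\mu(B(\xi,2r))\leq C_{\mu}\mu(B(\xi,r))$ for all $\xi\in4M_{0}B_{\Delta_{0}}$ and $r\in(0,4M_{0}\ell(\Delta_{0}))$. Let $0<\delta<1<M<M_{0}/2$ and set $$\mathscr{P}_{M,\delta}=\{\Delta\in\mathscr{D}:\Delta\cap E\neq\emptyset,\ \exists\,\xi\in MB_{\Delta}\text{ such that }\operatorname{dist}(\xi,E)\geq\delta\ell(\Delta)\}.$$ Then there is $C_{1}=C_{1}(M,\delta,C_{\mu})>0$ so that, for all cubes $\Delta'\subseteq\Delta_{0}$, $$\sum_{\Delta\subseteq\Delta',\ \Delta\in\mathscr{P}_{M,\delta}}\mu(\Delta)\leq C_{1}\mu(\Delta').$$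
   Context: Cubes: fix constants $c_0<1/1000$ and $c_1=1/500$. For a metric space $\Sigma$ and an increasing sequence of maximal $c_0^n$-separated sets $X_n\subseteq\Sigma$ ($n\in\mathbb{Z}$), there are (Christ, David, Hytönen–Martikainen) collections $\mathscr{D}_n$ of Borel subsets (''cubes'') of $\Sigma$ such that (1) $\Sigma=\bigcup_{\Delta\in\mathscr{D}_n}\Delta$ for every $n$; (2) if $\Delta,\Delta'\in\mathscr{D}=\bigcup_n\mathscr{D}_n$ intersect, then $\Delta\subseteq\Delta'$ or $\Delta'\subseteq\Delta$; (3) for $\Delta\in\mathscr{D}_n$ there is a center $\zeta_\Delta\in X_n$ so that, with $\ell(\Delta)=5c_0^n$ and $B_\Delta=B(\zeta_\Delta,\ell(\Delta))$, $c_1B_\Delta\subseteq\Delta\subseteq B_\Delta$. Here balls $B(x,r)$ are open balls in $\Sigma$ and $\lambda B(x,r)=B(x,\lambda r)$. A cube carries its generation $n$ (so $\ell(\Delta)$ is well defined), and $\Delta\subseteq\Delta'$ for cubes is understood with the generation of $\Delta$ at least that of $\Delta'$. The constants $c_0,c_1$ are regarded as fixed. *)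

(* Defs.v *)
From HB Require Import structures.
From mathcomp Require Import all_boot all_order all_algebra.
From mathcomp Require Import all_classical all_reals all_analysis.

Set Implicit Arguments.
Unset Strict Implicit.
Unset Printing Implicit Defensive.

Import Order.TTheory GRing.Theory Num.Theory.
Import numFieldNormedType.Exports.

Local Open Scope classical_set_scope.
Local Open Scope ring_scope.

(* [g_sigma_algebraType] is a [measurableType] only over a pointed type, and
   [metricType] does not include a point. *)
#[short(type="pmetricType")]
HB.structure Definition PMetric (K : numDomainType) :=
  { M of Metric K M & isPointed M }.

Definition borel (K : numDomainType) (X : pmetricType K) :=
  g_sigma_algebraType (@open X).

Definition msupp (R : realType) (X : pmetricType R)
    (mu : {measure set (borel X) -> \bar R}) : set X :=
  [set x | forall r : R, 0 < r -> (0 < mu (ball x r))%E].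

Definition dist_separated (R : realType) (X : pmetricType R) (e : R) (A : set X) :=
  forall x y, A x -> A y -> x <> y -> e <= mdist x y.

Definition maximal_separated (R : realType) (X : pmetricType R)
    (S : set X) (e : R) (A : set X) :=
  [/\ A `<=` S, dist_separated e A &
      forall B : set X, A `<=` B -> B `<=` S -> dist_separated e B -> B = A].

(* A cube is a pair (generation, underlying set): the same set may occur in
   several generations, and then counts as several cubes. *)
Definition cube (R : realType) (X : pmetricType R) : Type := (int * set X)%type.

Definition cube_side (R : realType) (X : pmetricType R) (c0 : R) (Q : cube X) : R :=
  5 * c0 ^ Q.1.

Definition subcube (R : realType) (X : pmetricType R) (Q Q' : cube X) :=
  Q'.1 <= Q.1 /\ Q.2 `<=` Q'.2.

(* Open ball of the subspace S. *)
Definition sball (R : realType) (X : pmetricType R) (S : set X)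
    (x : X) (r : R) : set X :=
  S `&` ball x r.

Definition cst1 {R : realType} : R := 500%:R^-1.

Record cubes (R : realType) (X : pmetricType R) (c0 : R) (S : set X) := Cubes {
  cube_net : int -> set X;
  in_cubes : set (cube X);
  cube_ctr : cube X -> X;
  net_increasing : forall n : int, cube_net n `<=` cube_net (n + 1);
  net_maximal : forall n : int, maximal_separated S (c0 ^ n) (cube_net n);
  cube_borel : forall Q, in_cubes Q -> measurable (Q.2 : set (borel X));
  cube_cover : forall n : int,
    S = \bigcup_(A in [set A | in_cubes (n, A)]) A;
  cube_nested : forall Q Q', in_cubes Q -> in_cubes Q' ->
    Q.2 `&` Q'.2 !=set0 -> subcube Q Q' \/ subcube Q' Q;
  cube_center : forall Q, in_cubes Q -> cube_net Q.1 (cube_ctr Q);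
  cube_inner : forall Q, in_cubes Q ->
    sball S (cube_ctr Q) (cst1 * cube_side c0 Q) `<=` Q.2;
  cube_outer : forall Q, in_cubes Q ->
    Q.2 `<=` sball S (cube_ctr Q) (cube_side c0 Q)
}.

(* [cball D lambda Q] is the dilated ball lambda B_Q. *)
Definition cball (R : realType) (X : pmetricType R) (c0 : R) (S : set X)
    (D : cubes c0 S) (lambda : R) (Q : cube X) : set X :=
  sball S (cube_ctr D Q) (lambda * cube_side c0 Q).

Definition porous_cubes (R : realType) (X : pmetricType R) (c0 : R) (S : set X)
    (D : cubes c0 S) (E : set X) (M delta : R) : set (cube X) :=
  [set Q | [/\ in_cubes D Q, Q.2 `&` E !=set0 &
    exists2 xi, cball D M Q xi & ((delta * cube_side c0 Q)%:E <= edist_inf E xi)%E]].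

(* Main.v *)
Require Import Defs.
From HB Require Import structures.
From mathcomp Require Import all_boot all_order all_algebra.
From mathcomp Require Import all_classical all_reals all_analysis.
From mathcomp Require Import measurable_realfun.
From mathcomp Require Import lra zify.

(** A cube Q of the porous family carries a hole: a ball H_Q around some xi in
    M B_Q, of radius delta l(Q) / 2, all of whose points are at distance more
    than delta l(Q) / 2 from E, while Q itself meets E.  Doubling gives
    mu(Q) <= C mu(H_Q) (cube_le_hole), and for Q inside Q' every hole lies in a
    fixed dilate of B_Q', whose measure is at most C mu(Q') (dilated_cube_le).
    So the packing estimate follows once the holes are shown to have bounded
    overlap (hole_overlap), since then the sum of mu(H_Q) is at most a constant
    times the measure of the dilate (sum_measure_le_overlap).

    Suppose that x lies in H_Q and in H_Q1.  The distance from x to E is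
    at least delta l(Q) / 2 and at most (M + 2) l(Q1), and the same with Q and
    Q1 exchanged.  Hence the generations of the cubes whose hole contains x lie
    in a window of bounded length W (side_compare).  It remains to bound the
    number of cubes of one generation near x.  The axioms of cubes do not say
    that distinct cubes of the same generation are disjoint: they may be
    strictly nested, with the same center, so that a volume count does not
    apply directly.  However, a cube is the union of the cubes of any strictly
    finer generation n that meet it, hence is determined by the points of the
    net of generation n that it contains (cube_determined_by_net).  If n bounds
    the window from above, only N points of this net are close to x, by
    separation and doubling, and at most (W + 1) 2^N cubes can occur.

    If mu(Q') is infinite or zero the estimate is immediate; both cases are set
    apart because the count of net points divides by the measure of a ball. *)

Import Order.TTheory GRing.Theory Num.Theory.
Import numFieldNormedType.Exports.
Local Open Scope classical_set_scope.
Local Open Scope ring_scope.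

(** * Measures and counting *)

(** Integrate the inequality between the sum of the indicators of the [A i] and
    [N] times the indicator of [B]. *)
Lemma sum_measure_le_overlap {d} {T : measurableType d} {R : realType}
    (mu : {measure set T -> \bar R}) {I : eqType} (s : seq I) (A : I -> set T)
    (B : set T) (N : nat) :
  (forall i, measurable (A i)) -> measurable B ->
  {in s, forall i, A i `<=` B} ->
  (forall x, count (fun i => `[< A i x >]) s <= N)%N ->
  (\sum_(i <- s) mu (A i) <= N%:R%:E * mu B)%E.
Proof.
move=> mA mB AB overlap.
have mind (C : set T) : measurable C ->
    measurable_fun setT (fun x => (\1_C x : R)%:E).
  by move=> mC; apply/measurable_EFinP; exact: measurable_indic.
have indE (C : set T) : measurable C ->
    (\int[mu]_(x in setT) (\1_C x)%:E)%E = mu C.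
  by move=> mC; rewrite integral_indic// setIT.
rewrite -(indE _ mB) -ge0_integralZl//; last exact: mind.
under eq_bigr do rewrite -indE//.
rewrite -ge0_integral_sum//; last by move=> i; exact: mind.
apply: ge0_le_integral => //.
- by move=> x _; apply: sume_ge0 => i _; rewrite lee_fin indicE ler0n.
- by apply: emeasurable_sum => i; exact: mind.
- by apply: measurable_funeM; exact: mind.
move=> x _; rewrite sumEFin -EFinM lee_fin.
have -> : \sum_(i <- s) \1_(A i) x = (count (fun i => `[< A i x >]) s)%:R :> R.
  rewrite -sum1_count natr_sum [RHS]big_mkcond/=; apply: eq_bigr => i _.
  by rewrite indicE; case: asboolP => Aix; [rewrite mem_set|rewrite memNset].
rewrite indicE; case: (asboolP (B x)) => Bx.
  by rewrite mem_set// mulr1 ler_nat.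
rewrite memNset// mulr0 lern0 -leqn0 leqNgt -has_count.
by apply/hasPn => i si; apply/asboolPn => /(AB i si).
Qed.

Lemma seq_of_bounded {T : eqType} (A : set T) (N : nat) :
  (forall s : seq T, uniq s -> {in s, forall x, A x} -> (size s <= N)%N) ->
  exists2 s : seq T, (size s <= N)%N & forall x, A x -> x \in s.
Proof.
move=> bnd.
pose P k := `[< exists s : seq T, [/\ uniq s, {in s, forall x, A x} & size s = k] >].
have exP : exists k, P k by exists 0%N; apply/asboolP; exists [::].
have ubP k : P k -> (k <= N)%N by move=> /asboolP[s [us sA <-]]; exact: bnd.
case: (ex_maxnP exP ubP) => k /asboolP[s [us sA szs]] kmax.
exists s => [|x Ax]; first exact: bnd.
apply: contraT => xs.
have /kmax : P k.+1.
  apply/asboolP; exists (x :: s); rewrite /= xs us szs; split=> // y.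
  by rewrite inE => /predU1P[->|/sA].
by rewrite ltnn.
Qed.

(** [x] is encoded by the number [g x] and the bit vector of [h x] along [z]; the
    last hypothesis makes the encoding injective. *)
Lemma size_le_codes {T U : eqType} (t : seq T) (z : seq U) (W : nat)
    (g : T -> nat) (h : T -> U -> bool) :
  uniq t -> {in t, forall x, (g x <= W)%N} ->
  {in t &, forall x y, g x = g y -> {in z, h x =1 h y} -> x = y} ->
  (size t <= W.+1 * 2 ^ size z)%N.
Proof.
move=> ut gW inj.
pose code x : 'I_W.+1 * (size z).-tuple bool :=
  (inord (g x), map_tuple (h x) (in_tuple z)).
have ucode : uniq (map code t).
  rewrite map_inj_in_uniq// => x y xt yt [].
  move=> /(congr1 (@nat_of_ord _)); rewrite !inordK ?ltnS ?gW// => gxy hxy.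
  by apply: inj => // u uz; move/eq_in_map: hxy; apply.
rewrite -(size_map code) -(card_uniqP ucode) (leq_trans (max_card _))//.
by rewrite card_prod card_ord card_tuple card_bool.
Qed.

Lemma exists_pow2_ge {R : realType} (a b : R) : 0 < b ->
  exists k : nat, a <= 2 ^+ k * b.
Proof.
move=> b0; exists (Num.bound `|a / b|).
rewrite -ler_pdivrMr//; apply: le_trans (ler_norm _) _.
apply: le_trans (ltW (archi_boundP (normr_ge0 _))) _.
by rewrite -natrX ler_nat; apply: ltnW; exact: ltn_expl.
Qed.

Lemma exists_exp_small {R : realType} (c a : R) : 0 < c -> c <= 2^-1 -> 0 < a ->
  exists W : nat, c ^+ W <= a.
Proof.
move=> c0 c2 a0; have [W Wa] := exists_pow2_ge 1 a a0; exists W.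
apply: le_trans (_ : 2^-1 ^+ W <= a).
  by rewrite lerXn2r// ?nnegrE ltW// invr_gt0.
by rewrite exprVn -[leLHS]mulr1 ler_pdivrMl// exprn_gt0.
Qed.

(** Halving [s] at each step keeps every argument of the doubling inequality below
    [T], even though [2 ^+ k * r] may be much larger than [2 * T]. *)
Lemma doubling_iter {R : realType} (f : R -> \bar R) (C T : R) (k : nat) (s r : R) :
  0 <= C ->
  (forall u v : R, u <= v -> (f u <= f v)%E) ->
  (forall u : R, 0 < u -> u < T -> (f (2 * u)%R <= C%:E * f u)%E) ->
  0 < s -> s < 2 * T -> s <= 2 ^+ k * r ->
  (f s <= (C ^+ k)%:E * f r)%E.
Proof.
move=> C0 fmono fdbl; elim: k s => [|k IH] s s0 sT.
  by rewrite !expr0 !mul1r mul1e; exact: fmono.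
rewrite exprS => sr.
have -> : s = 2 * (s / 2) by lra.
have s2 : 0 < s / 2 by lra.
apply: le_trans (fdbl _ s2 _) _; first lra.
rewrite exprS EFinM -muleA lee_wpmul2l ?lee_fin// IH//; lra.
Qed.

(** Packing: disjoint pieces of [B], each carrying a fraction at least [K^-1] of its
    mass. *)
Lemma card_disjoint_family {d} {T : measurableType d} {R : realType}
    (mu : {measure set T -> \bar R}) {I : eqType} (s : seq I) (A : I -> set T)
    (B : set T) (K : R) :
  uniq s -> (forall i, measurable (A i)) -> measurable B ->
  (0 < mu B)%E -> (mu B < +oo)%E -> 0 <= K ->
  {in s, forall i, A i `<=` B} ->
  {in s &, forall i j, A i `&` A j !=set0 -> i = j} ->
  {in s, forall i, (mu B <= K%:E * mu (A i))%E} ->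
  (size s)%:R <= K.
Proof.
move=> us mA mB B0 Boo K0 AB disj massive.
have Bfin : mu B \is a fin_num by rewrite ge0_fin_numE.
rewrite -lee_fin -(@lee_pmul2r _ (mu B))//.
have -> : ((size s)%:R%:E * mu B = \sum_(i <- s) mu B)%E.
  rewrite -(fineK Bfin) sumEFin -EFinM big_const_seq count_predT iter_addr_0.
  by rewrite mulr_natl.
apply: le_trans (_ : (\sum_(i <- s) K%:E * mu (A i) <= _)%E).
  by rewrite !big_seq; apply: lee_sum => i /massive.
rewrite -ge0_sume_distrr//.
rewrite lee_wpmul2l ?lee_fin// -[leRHS]mul1e.
apply: (sum_measure_le_overlap mu s A B 1) => // x.
rewrite leqNgt; apply/negP.
rewrite -size_filter; case E : [seq _ <- s | _] => [|i [|j l]]// _.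
have := filter_uniq (fun i => `[< A i x >]) us; rewrite E/= inE negb_or.
have : i \in [seq i <- s | `[< A i x >]] by rewrite E mem_head.
have : j \in [seq i <- s | `[< A i x >]] by rewrite E !inE eqxx orbT.
rewrite !mem_filter => /andP[/asboolP Ajx sj] /andP[/asboolP Aix si].
by rewrite (disj i j)// ?eqxx//; exists x.
Qed.

Lemma expz_shift {R : realType} (c : R) (m n : int) (W : nat) :
  0 < c -> c <= 1 -> m + W%:Z <= n -> c ^ n <= c ^ m * c ^+ W.
Proof.
move=> c0 c1 mn; have cn0 : c != 0 by rewrite gt_eqF.
have [k ->] : exists k : nat, n = m + W%:Z + k%:Z.
  by exists (absz (n - (m + W%:Z))%R); lia.
rewrite !expfzDr// -!exprnP ler_piMr//; last by rewrite exprn_ile1// ltW.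
by rewrite mulr_ge0// ?exprn_ge0 ?exprz_ge0 ?ltW.
Qed.

(** * Balls, support and Borel sets *)

Lemma open_mball {R : realType} {X : pmetricType R} (x : X) (r : R) :
  open (ball x r).
Proof.
rewrite openE => y; rewrite ballEmdist/= => xyr.
apply/nbhs_ballP; exists (r - mdist x y); first by rewrite /= subr_gt0.
move=> z; rewrite !ballEmdist/= => yz.
by have := metric_triangle x y z; lra.
Qed.

Section borel_support.
Context {R : realType} {X : pmetricType R}.
Context (mu : {measure set (borel X) -> \bar R}).

Lemma le_mu (A B : set (borel X)) : measurable A -> measurable B ->
  A `<=` B -> (mu A <= mu B)%E.
Proof. by move=> mA mB; apply: le_measure; rewrite inE. Qed.

Lemma borel_open (A : set X) : open A -> measurable (A : set (borel X)).
Proof. by move=> oA; apply: sub_sigma_algebra. Qed.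

Lemma borel_ball (x : X) (r : R) : measurable (ball x r : set (borel X)).
Proof. by apply: borel_open; exact: open_mball. Qed.

(** A ball of measure zero contains a ball of
    measure zero around each of its points. *)
Lemma closed_msupp : closed (msupp mu).
Proof.
rewrite -openC openE => x /= /existsNP[r /not_implyP[r0 /negP]].
rewrite -leNgt => ballx0; apply/nbhs_ballP; exists r => //= y xy suppy.
have := xy; rewrite ballEmdist/= => xyr.
have ry0 : 0 < r - mdist x y by rewrite subr_gt0.
have := suppy _ ry0; rewrite ltNge => /negP; apply.
apply: le_trans ballx0; apply: le_mu; [exact: borel_ball|exact: borel_ball|].
move=> z; rewrite !ballEmdist/= => yz.
by have := metric_triangle x y z; lra.
Qed.

Lemma measurable_sball (x : X) (r : R) :
  measurable (sball (msupp mu) x r : set (borel X)).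
Proof.
apply: measurableI; last exact: borel_ball.
rewrite -[msupp mu]setCK; apply: measurableC; apply: borel_open.
by rewrite openC; exact: closed_msupp.
Qed.

End borel_support.

Lemma sub_sball {R : realType} {X : pmetricType R} (S : set X) (x y : X) (r s : R) :
  mdist y x + r <= s -> sball S x r `<=` sball S y s.
Proof.
move=> yxs z [Sz]; rewrite /sball/= !ballEmdist/= => xz; split=> //=.
by have := metric_triangle y x z; lra.
Qed.

(** * Geometry of cubes *)

Section cube_geometry.
Context {R : realType} {c0 : R} {X : pmetricType R} {S : set X}.
Context (c0_gt0 : 0 < c0) (c0_le1 : c0 <= 1) {D : cubes c0 S}.

Lemma cube_side_gt0 (Q : cube X) : 0 < cube_side c0 Q.
Proof. by rewrite mulr_gt0// exprz_gt0. Qed.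

Lemma cube_side_shift {Q Q' : cube X} {W : nat} :
  Q'.1 + W%:Z <= Q.1 -> cube_side c0 Q <= cube_side c0 Q' * c0 ^+ W.
Proof. by move=> QQ'; rewrite -mulrA ler_pM2l// expz_shift. Qed.

Lemma cube_side_le {Q Q' : cube X} :
  Q'.1 <= Q.1 -> cube_side c0 Q <= cube_side c0 Q'.
Proof.
by move=> QQ'; have := @cube_side_shift Q Q' 0; rewrite addr0 mulr1; exact.
Qed.

Lemma cube_ctr_supp {Q : cube X} : in_cubes D Q -> S (cube_ctr D Q).
Proof. by move=> /cube_center; case: (net_maximal D Q.1) => + _ _; exact. Qed.

Lemma cube_ctr_mem {Q : cube X} : in_cubes D Q -> Q.2 (cube_ctr D Q).
Proof.
move=> DQ; apply: (cube_inner DQ); split; first exact: cube_ctr_supp.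
by rewrite ballEmdist/= mdistxx mulr_gt0 ?cube_side_gt0// invr_gt0 ltr0n.
Qed.

Lemma cube_supp {Q : cube X} : in_cubes D Q -> Q.2 `<=` S.
Proof. by move=> DQ; apply: subset_trans (cube_outer DQ) _ => y []. Qed.

Lemma cube_ctr_dist {Q : cube X} {y : X} : in_cubes D Q -> Q.2 y ->
  mdist (cube_ctr D Q) y < cube_side c0 Q.
Proof. by move=> DQ /(cube_outer DQ)[_]; rewrite ballEmdist. Qed.

(** Nestedness forces a cube that meets a cube of a strictly coarser generation to
    lie inside it, the reverse inclusion being excluded by the generations. *)
Lemma finer_cube {Q : cube X} {n : int} {x : X} :
  in_cubes D Q -> Q.1 < n -> Q.2 x ->
  exists P, [/\ in_cubes D P, P.1 = n & P.2 x] /\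
    forall Q1, in_cubes D Q1 -> Q1.1 < n -> P.2 `&` Q1.2 !=set0 ->
      P.2 `<=` Q1.2.
Proof.
move=> DQ Qn Qx; have := cube_supp DQ _ Qx.
rewrite {1}(cube_cover D n) => -[A DA Ax]; exists (n, A); split=> // Q1 DQ1 Q1n.
by move=> /(cube_nested DA DQ1)[[]//|[]]; rewrite leNgt Q1n.
Qed.

(** Through any point of [Q] passes a cube of generation [n] inside [Q]; if its center
    belongs to [Q1] then it meets [Q1], hence lies inside [Q1] as well. *)
Lemma sub_cube_of_net {Q Q1 : cube X} {n : int} :
  in_cubes D Q -> in_cubes D Q1 -> Q.1 < n -> Q1.1 < n ->
  (forall z, cube_net D n z -> Q.2 z -> Q1.2 z) -> Q.2 `<=` Q1.2.
Proof.
move=> DQ DQ1 Qn Q1n netQ x Qx.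
have [P [[DP Pn Px] sub]] := finer_cube DQ Qn Qx.
have Pz := cube_ctr_mem DP.
have Qz : Q.2 (cube_ctr D P) by apply: (sub Q) => //; exists x.
apply: (sub Q1) => //; exists (cube_ctr D P); split=> //.
by apply: netQ => //; rewrite -Pn; exact: cube_center.
Qed.

(** This is what bounds the number of cubes of a generation: they are counted by the
    sets of finer net points that they contain. *)
Lemma cube_determined_by_net {Q Q1 : cube X} {n : int} :
  in_cubes D Q -> in_cubes D Q1 -> Q.1 = Q1.1 -> Q.1 < n ->
  (forall z, cube_net D n z -> Q.2 z <-> Q1.2 z) -> Q = Q1.
Proof.
case: Q Q1 => [m A] [m' B] DQ DQ1 /= mm' mn netQ; subst m'; congr (_, _).
apply/seteqP; split.
- by apply: (@sub_cube_of_net (m, A) (m, B) n) => // z /netQ[].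
- by apply: (@sub_cube_of_net (m, B) (m, A) n) => // z /netQ[].
Qed.

End cube_geometry.

Lemma le_mdist_of_edist_inf {R : realType} {X : pmetricType R} (E : set X)
    (x e : X) (a : R) :
  (a%:E <= edist_inf E x)%E -> E e -> a <= mdist x e.
Proof.
move=> aE Ee; apply/ler_addgt0Pr => eta eta0; rewrite -lee_fin.
apply: le_trans aE _; apply: (@le_trans _ _ (edist (x, e))).
  by apply: ereal_inf_lbound; exists e.
apply: edist_fin; first by have := mdist_ge0 x e; lra.
by rewrite ballEmdist/= ltrDl.
Qed.

(** * Doubling near a cube *)

Lemma absz_sub_le (a b : int) (W : nat) :
  b <= a -> a < b + W%:Z -> (absz (a - b)%R <= W)%N.
Proof. by lia. Qed.

Lemma absz_sub_inj (a b c : int) :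
  b <= a -> b <= c -> absz (a - b)%R = absz (c - b)%R -> a = c.
Proof. by lia. Qed.

Section porous_cubes.
Context {R : realType} {c0 : R} {X : pmetricType R}.
Context {mu : {measure set (borel X) -> \bar R}}.
Context (c0_gt0 : 0 < c0) (c0_le1 : c0 <= 1) (D : cubes c0 (msupp mu)).

Local Notation S := (msupp mu).
Local Notation side := (cube_side c0).
Local Notation ctr := (cube_ctr D).

(** Iterated doubling at all scales up to a multiple of the side of [Q']; it is the only
    trace of the ambient cube and of its dilation factor in the estimates below.
    The center range [M + 1] covers the dilates [M B_Q] of the subcubes, and [2 * M + 5]
    is the largest radius, in units of the side, that the overlap count uses. *)
Definition doubling_chain (M C : R) (Q' : cube X) := forall xi s r (k : nat),
  S xi -> mdist (ctr Q') xi < (M + 1) * side Q' ->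
  0 < s -> s <= (2 * M + 5) * side Q' -> s <= 2 ^+ k * r ->
  (mu (sball S xi s) <= (C ^+ k)%:E * mu (sball S xi r))%E.

(** The two ranges fit because [2 * M < M0]: the points are within [(M + 2) * side Q0]
    of the center of [Q0], and [2 * M + 5 < 8 * M0]. *)
Lemma doubling_chain_subcube (M M0 C : R) (Q0 Q' : cube X) :
  0 <= C -> 1 < M -> M < M0 / 2 ->
  in_cubes D Q0 -> in_cubes D Q' -> subcube Q' Q0 ->
  (forall (xi : X) (r : R), cball D (4 * M0) Q0 xi ->
     0 < r -> r < 4 * M0 * side Q0 ->
     (mu (sball S xi (2 * r)) <= C%:E * mu (sball S xi r))%E) ->
  doubling_chain M C Q'.
Proof.
move=> C0 M1 MM0 DQ0 DQ' [gen sub] dbl xi s r k Sxi xiQ' s0 sM sr.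
have l0 := cube_side_gt0 c0_gt0 Q'.
have ll : side Q' <= side Q0 by exact: cube_side_le.
have ctrQ' := cube_ctr_dist DQ0 (sub _ (cube_ctr_mem c0_gt0 DQ')).
have ML (a : R) : 0 <= a -> a * side Q' <= a * side Q0.
  by move=> a0; rewrite ler_wpM2l.
have M0L : (M + 1 + M + 1) * side Q0 < 4 * M0 * side Q0.
  by rewrite ltr_pM2r; lra.
have M5L : (2 * M + 5) * side Q0 < 2 * (4 * M0) * side Q0.
  by rewrite ltr_pM2r; lra.
have MQ0 : 0 < M * side Q0 by rewrite mulr_gt0; lra.
apply: (doubling_iter (fun u => mu (sball S xi u)) C (4 * M0 * side Q0)) => //.
- move=> u v uv; apply: le_mu; try exact: measurable_sball.
  by apply: sub_sball; rewrite mdistxx add0r.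
- move=> u u0 uT; apply: dbl => //; split=> //; rewrite ballEmdist/=.
  have := metric_triangle (ctr Q0) (ctr Q') xi.
  have /ML : 0 <= M + 1 by lra.
  by lra.
- have /ML : 0 <= 2 * M + 5 by lra.
  by lra.
Qed.

Section fixed_cube.
Context {M C : R} {Q' : cube X}.
Context (C_ge0 : 0 <= C).
Context (DQ' : in_cubes D Q') (chain : doubling_chain M C Q').

(** [Q'] contains the ball of radius [cst1 * side Q'] around its center, from which
    doubling reaches the dilated ball. *)
Lemma dilated_cube_le (k : nat) : 1 < M -> 2 * M + 5 <= 2 ^+ k * cst1 ->
  (mu (sball S (ctr Q') ((2 * M + 5) * side Q')) <= (C ^+ k)%:E * mu Q'.2)%E.
Proof.
move=> M1 Mk; have l0 := cube_side_gt0 c0_gt0 Q'.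
apply: (@le_trans _ _ ((C ^+ k)%:E * mu (sball S (ctr Q') (cst1 * side Q')))%E).
  apply: chain => //.
  - exact: (cube_ctr_supp DQ').
  - by rewrite mdistxx mulr_gt0//; lra.
  - by rewrite mulr_gt0//; lra.
  - by rewrite [leRHS](mulrA _ _ (side _)) ler_pM2r.
rewrite lee_wpmul2l ?lee_fin ?exprn_ge0//; apply: le_mu.
- exact: measurable_sball.
- exact: (cube_borel DQ').
- exact: (cube_inner DQ').
Qed.

Lemma subcube_side_le {Q : cube X} : subcube Q Q' -> side Q <= side Q'.
Proof. by case=> + _; exact: cube_side_le. Qed.

Lemma hole_ctr_near {Q : cube X} {xi : X} : 1 < M -> in_cubes D Q -> subcube Q Q' ->
  cball D M Q xi -> mdist (ctr Q') xi < (M + 1) * side Q'.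
Proof.
move=> M1 DQ QQ' [_]; rewrite ballEmdist/= => Qxi.
have := subcube_side_le QQ'; rewrite -(ler_pM2l (_ : 0 < M)); last lra.
have := cube_ctr_dist DQ' (QQ'.2 _ (cube_ctr_mem c0_gt0 DQ)).
by have := metric_triangle (ctr Q') (ctr Q) xi; lra.
Qed.

(** [Q] lies in the ball of radius [(M + 1) * side Q] around the center of the hole. *)
Lemma cube_le_hole (delta : R) (k : nat) (Q : cube X) (xi : X) :
  1 < M -> 0 < delta -> M + 1 <= 2 ^+ k * (delta / 2) ->
  in_cubes D Q -> subcube Q Q' -> cball D M Q xi ->
  (mu Q.2 <= (C ^+ k)%:E * mu (sball S xi (delta / 2 * side Q)))%E.
Proof.
move=> M1 delta0 Mk DQ QQ' Qxi; have l0 := cube_side_gt0 c0_gt0 Q.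
have ll := subcube_side_le QQ'.
apply: (@le_trans _ _ (mu (sball S xi ((M + 1) * side Q)))).
  apply: le_mu; [exact: (cube_borel DQ)|exact: measurable_sball|].
  apply: subset_trans (cube_outer DQ) _; apply: sub_sball.
  by have [_] := Qxi; rewrite ballEmdist/= metric_sym; lra.
apply: chain; first by case: Qxi.
- exact: (hole_ctr_near M1 DQ).
- by rewrite mulr_gt0//; lra.
- rewrite -(ler_pM2l (_ : 0 < M + 1)) in ll; last lra.
  apply: le_trans ll _; rewrite ler_pM2r; last by have := subcube_side_le QQ'; lra.
  lra.
- by rewrite [leRHS](mulrA _ _ (side _)) ler_pM2r.
Qed.

Lemma hole_in_dilated_cube (delta : R) (Q : cube X) (xi : X) :
  1 < M -> delta < 1 -> in_cubes D Q -> subcube Q Q' -> cball D M Q xi ->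
  sball S xi (delta / 2 * side Q) `<=` sball S (ctr Q') ((2 * M + 5) * side Q').
Proof.
move=> M1 delta1 DQ QQ' Qxi; apply: sub_sball.
have := hole_ctr_near M1 DQ QQ' Qxi.
have l0 := cube_side_gt0 c0_gt0 Q; have ll := subcube_side_le QQ'.
have : delta / 2 * side Q <= 1 * side Q by rewrite ler_pM2r//; lra.
have : 1 * side Q' <= M * side Q' by rewrite ler_pM2r; lra.
by lra.
Qed.

(** * Overlap of the holes *)

(** A common point [x] of two holes is at distance at least [delta / 2 * side Q] from
    [E], because of the first hole, and less than [(M + 2) * side Q1] from a point of
    [E] in [Q1], because of the second. *)
Lemma side_compare (E : set X) (delta : R) (Q Q1 : cube X) (xi xi1 x : X) :
  delta < 1 -> in_cubes D Q1 -> Q1.2 `&` E !=set0 ->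
  ((delta * side Q)%:E <= edist_inf E xi)%E -> cball D M Q1 xi1 ->
  sball S xi (delta / 2 * side Q) x -> sball S xi1 (delta / 2 * side Q1) x ->
  delta / 2 * side Q < (M + 2) * side Q1.
Proof.
move=> delta1 DQ1 [e [Q1e Ee]] /le_mdist_of_edist_inf/(_ Ee) xie [_ Q1xi1].
move=> [_ xix] [_ xi1x]; move: Q1xi1 xix xi1x; rewrite !ballEmdist/=.
move=> Q1xi1 xix xi1x; have Q1l := cube_ctr_dist DQ1 Q1e.
have l1 := cube_side_gt0 c0_gt0 Q1.
have : delta / 2 * side Q1 <= 1 * side Q1 by rewrite ler_pM2r//; lra.
have := metric_triangle xi x e; have := metric_triangle x xi1 e.
have := metric_triangle xi1 (ctr Q1) e.
rewrite (metric_sym x xi1) (metric_sym xi1 (ctr Q1)); lra.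
Qed.

(** The net is [c0 ^ n]-separated, so the balls of half that radius are disjoint. *)
Lemma net_points_bounded (n : int) (s : seq X) (U : set X) (K : R) :
  uniq s -> {in s, forall z, cube_net D n z} ->
  measurable (U : set (borel X)) -> (0 < mu U)%E -> (mu U < +oo)%E -> 0 <= K ->
  {in s, forall z, sball S z (c0 ^ n / 2) `<=` U} ->
  {in s, forall z, (mu U <= K%:E * mu (sball S z (c0 ^ n / 2)))%E} ->
  (size s)%:R <= K.
Proof.
move=> us net mU U0 Uoo K0 sub massive.
apply: (card_disjoint_family mu s (fun z => sball S z (c0 ^ n / 2)) U) => //.
  by move=> z; exact: measurable_sball.
move=> z z1 /net netz /net netz1 [y [[_ zy] [_ z1y]]]; apply: contrapT => zz1.
have [_ sep _] := net_maximal D n.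
move: zy z1y; rewrite !ballEmdist/=.
have := sep _ _ netz netz1 zz1.
have := metric_triangle z y z1; rewrite (metric_sym y z1); lra.
Qed.

Lemma exists_coarsest (t : seq (cube X)) : t != [::] ->
  exists2 Qb, Qb \in t & {in t, forall Q, Qb.1 <= Q.1}.
Proof.
elim: t => [//|Q [|Q1 t] IH] _.
  by exists Q => [|P]; rewrite ?mem_head// inE => /eqP->.
have [//|Qb Qbt Qbmin] := IH.
have [QQb|QbQ] := leP Q.1 Qb.1.
  exists Q => [|P]; rewrite ?mem_head// inE => /predU1P[->//|/Qbmin].
  exact: le_trans.
exists Qb => [|P]; rewrite inE ?Qbt ?orbT// => /predU1P[->|/Qbmin//].
exact: ltW.
Qed.

(** The number of doublings needed here depends on [Q], but only positivity is claimed: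
    if [U] were null, so would be a ball around the center of [Q] that contains [Q']. *)
Lemma ball_around_subcube_gt0 (Q : cube X) (U : set X) : 1 < M ->
  in_cubes D Q -> subcube Q Q' -> measurable (U : set (borel X)) -> Q.2 `<=` U ->
  (0 < mu Q'.2)%E -> (0 < mu U)%E.
Proof.
move=> M1 DQ QQ' mU QU mu0.
have l0 := cube_side_gt0 c0_gt0 Q; have l0' := cube_side_gt0 c0_gt0 Q'.
have QQ'l := cube_ctr_dist DQ' (QQ'.2 _ (cube_ctr_mem c0_gt0 DQ)).
have cl0 : 0 < cst1 * side Q by rewrite mulr_gt0// invr_gt0 ltr0n.
have [k kl] := exists_pow2_ge (2 * side Q') _ cl0.
have Ml : 1 * side Q' < M * side Q' by rewrite ltr_pM2r.
suff : (0 < (C ^+ k)%:E * mu U)%E.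
  by apply: contraTT; rewrite -!leNgt measure_le0 => /eqP->; rewrite mule0.
apply: (lt_le_trans mu0).
apply: (@le_trans _ _ (mu (sball S (ctr Q) (2 * side Q')))).
  apply: le_mu; [exact: (cube_borel DQ')|exact: measurable_sball|].
  apply: subset_trans (cube_outer DQ') _; apply: sub_sball.
  by rewrite metric_sym; lra.
apply: (@le_trans _ _ ((C ^+ k)%:E * mu (sball S (ctr Q) (cst1 * side Q)))%E).
  apply: chain => //; [exact: (cube_ctr_supp DQ)|lra|lra|lra].
rewrite lee_wpmul2l ?lee_fin ?exprn_ge0//; apply: le_mu => //.
- exact: measurable_sball.
- exact: subset_trans (cube_inner DQ) QU.
Qed.

(** The net of generation [n], where [n - W] is the generation of the coarsest cube of
    [t], is finer than all cubes of [t] and has boundedly many points at the scale of the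
    coarsest one.  Each cube is encoded by its generation, relative to the coarsest, and
    by the net points that it contains. *)
Lemma hole_overlap (E : set X) (delta : R) (W N k2 k3 : nat)
    (hole : cube X -> X) (t : seq (cube X)) (x : X) :
  1 < M -> 0 < delta -> delta < 1 ->
  c0 ^+ W <= delta / (2 * (M + 2)) ->
  2 * M + 5 <= 2 ^+ k2 * cst1 ->
  (2 * M + 5) * 5 <= 2 ^+ k3 * (c0 ^+ W / 2) ->
  C ^+ k3 <= N%:R ->
  (0 < mu Q'.2)%E -> (mu Q'.2 < +oo)%E ->
  uniq t ->
  {in t, forall Q, [/\ in_cubes D Q, subcube Q Q' & Q.2 `&` E !=set0]} ->
  {in t, forall Q, cball D M Q (hole Q) /\
    ((delta * side Q)%:E <= edist_inf E (hole Q))%E} ->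
  {in t, forall Q, sball S (hole Q) (delta / 2 * side Q) x} ->
  (size t <= W.+1 * 2 ^ N)%N.
Proof.
move=> M1 delta0 delta1 Wdelta k2M k3M CN mu0 muoo ut tD th tx.
have [->//|/exists_coarsest[Qb Qbt Qbmin]] := eqVneq t [::].
have [DQb QbQ' QbE] := tD _ Qbt; have [Qbh hQb] := th _ Qbt.
have xQb := tx _ Qbt.
have lb0 := cube_side_gt0 c0_gt0 Qb; have lbQ' := subcube_side_le QbQ'.
set n := Qb.1 + W%:Z.
have near Q : Q \in t -> mdist x (ctr Q) < (M + 1) * side Q.
  move=> Qt; have [[_ +] _] := th _ Qt; have [_] := tx _ Qt.
  rewrite !ballEmdist/= => xh ch.
  have := cube_side_gt0 c0_gt0 Q => l0.
  have : delta / 2 * side Q <= 1 * side Q by rewrite ler_pM2r//; lra.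
  have := metric_triangle x (hole Q) (ctr Q).
  rewrite (metric_sym x (hole Q)) (metric_sym (hole Q) (ctr Q)); lra.
(* a cube at least W generations finer than Qb is too small for side_compare with Qb *)
have window Q : Q \in t -> Q.1 < n.
  move=> Qt; rewrite ltNge; apply/negP => /(cube_side_shift c0_gt0 c0_le1) lQ.
  have [DQ _ QE] := tD _ Qt; have [Qh _] := th _ Qt.
  have := side_compare _ _ _ _ _ _ _ delta1 DQ QE hQb Qh xQb (tx _ Qt).
  apply/negP; rewrite -leNgt.
  apply: (@le_trans _ _ ((M + 2) * (side Qb * c0 ^+ W))).
    by rewrite ler_pM2l//; lra.
  rewrite mulrCA mulrC ler_pM2r// mulrC.
  have M2 : 0 < 2 * (M + 2) by lra.
  move: Wdelta; rewrite ler_pdivlMr// => Wdelta; lra.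
set r1 := (M + 2) * side Qb.
pose Z : set X := [set z | [/\ cube_net D n z, Q'.2 z & mdist x z < r1]].
(* the net points in cubes of t are among at most N points *)
have [s Zs szs] : exists2 s : seq X, (size s <= N)%N & forall z, Z z -> z \in s.
  apply: seq_of_bounded => s us sZ; rewrite -(ler_nat R); apply: le_trans CN.
  (* U contains the disjoint balls around the points of Z, and lies within a
     comparable ball around each of these points *)
  pose U := sball S x ((M + 3) * side Qb).
  have mU : measurable (U : set (borel X)) by exact: measurable_sball.
  have cn : c0 ^ n = c0 ^ Qb.1 * c0 ^+ W by rewrite expfzDr ?gt_eqF.
  have cn_half : c0 ^ n / 2 <= side Qb.
    have : c0 ^ n <= c0 ^ Qb.1 by rewrite cn ler_piMr ?exprn_ile1 ?exprz_ge0// ltW.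
    have := exprz_gt0 Qb.1 c0_gt0; rewrite /cube_side; lra.
  have ML a b : 0 <= a -> a <= b -> a * side Qb <= b * side Q'.
    by move=> a0 ab; rewrite ler_pM// ltW.
  apply: (net_points_bounded n s U) => //.
  - by move=> z /sZ[].
  - apply: (ball_around_subcube_gt0 Qb) => //.
    apply: subset_trans (cube_outer DQb) _; apply: sub_sball.
    by have := near _ Qbt; lra.
  - apply: (@le_lt_trans _ _ (mu (sball S (ctr Q') ((2 * M + 5) * side Q')))).
      apply: le_mu => //; first exact: measurable_sball.
      apply: sub_sball; have := near _ Qbt.
      have := cube_ctr_dist DQ' (QbQ'.2 _ (cube_ctr_mem c0_gt0 DQb)).
      have := metric_triangle (ctr Q') (ctr Qb) x; rewrite (metric_sym x).
      have /(ML _ _)/(_ (lexx _)) : 0 <= 2 * M + 4 by lra.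
      lra.
    apply: le_lt_trans (dilated_cube_le k2 M1 k2M) _.
    by rewrite lte_mul_pinfty ?lee_fin ?exprn_ge0.
  - exact: exprn_ge0.
  - move=> z /sZ[_ _ xz]; apply: sub_sball; rewrite /r1 in xz; lra.
  - move=> z /sZ[_ Q'z xz]; have Sz := cube_supp DQ' _ Q'z.
    apply: (@le_trans _ _ (mu (sball S z ((2 * M + 5) * side Qb)))).
      apply: le_mu => //; first exact: measurable_sball.
      by apply: sub_sball; rewrite metric_sym; rewrite /r1 in xz; lra.
    apply: chain => //.
    + have := cube_ctr_dist DQ' Q'z.
      have : 0 < side Q' by exact: cube_side_gt0.
      have : 1 * side Q' <= M * side Q' by rewrite ler_pM2r; lra.
      lra.
    + by rewrite mulr_gt0//; lra.
    + by apply: ML; lra.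
    + move: k3M; rewrite cn /cube_side -(ler_pM2r (exprz_gt0 Qb.1 c0_gt0)).
      by move: (2 ^+ k3) (c0 ^+ W) (c0 ^ Qb.1) => a b c; lra.
apply: (@leq_trans (W.+1 * 2 ^ size s)); last by rewrite leq_mul2l leq_pexp2l.
apply: (size_le_codes t s W (fun Q => absz (Q.1 - Qb.1)) (fun Q z => `[< Q.2 z >])).
- exact: ut.
- by move=> Q Qt; apply: absz_sub_le; [exact: Qbmin|exact: window].
have in_s Q z : Q \in t -> cube_net D n z -> Q.2 z -> z \in s.
  move=> Qt netz Qz; have [DQ QQ' _] := tD _ Qt; apply: szs; split=> //.
    exact: QQ'.2.
  have := near _ Qt; have := cube_ctr_dist DQ Qz.
  have := metric_triangle x (ctr Q) z.
  have := cube_side_le c0_gt0 c0_le1 (Qbmin _ Qt).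
  rewrite -(ler_pM2l (_ : 0 < M + 2)) /r1; lra.
move=> Q P Qt Pt gQP hQP.
have [DQ _ _] := tD _ Qt; have [DP _ _] := tD _ Pt.
have QP1 : Q.1 = P.1 by exact: absz_sub_inj (Qbmin _ Qt) (Qbmin _ Pt) gQP.
apply: (cube_determined_by_net c0_gt0 DQ DP QP1 (window _ Qt)) => z netz; split.
- by move=> Qz; have := hQP _ (in_s _ _ Qt netz Qz); rewrite asboolT// => /esym/asboolP.
- by move=> Pz; have := hQP _ (in_s _ _ Pt netz Pz); rewrite [RHS]asboolT// => /asboolP.
Qed.

(** * The packing estimate *)

(** Besides [W], [N] and [k3], which govern the overlap, [k1] is the number of doublings
    from a hole to its cube and [k2] from [Q'] to the ball that contains all holes. *)
Lemma porous_sum_le (E : set X) (delta : R) (W N k1 k2 k3 : nat) :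
  1 < M -> 0 < delta -> delta < 1 -> 0 < C ->
  c0 ^+ W <= delta / (2 * (M + 2)) ->
  M + 1 <= 2 ^+ k1 * (delta / 2) ->
  2 * M + 5 <= 2 ^+ k2 * cst1 ->
  (2 * M + 5) * 5 <= 2 ^+ k3 * (c0 ^+ W / 2) ->
  C ^+ k3 <= N%:R ->
  ((\esum_(Q in [set Q | subcube Q Q' /\ porous_cubes D E M delta Q])
      mu Q.2)%R <=
   (C ^+ k1 * ((W.+1 * 2 ^ N)%N%:R * C ^+ k2))%:E * mu Q'.2)%E.
Proof.
move=> M1 delta0 delta1 C0 Wdelta k1M k2M k3M CN.
set C1 := C ^+ k1 * _.
have C10 : 0 < C1.
  by rewrite !mulr_gt0 ?exprn_gt0// ltr0n muln_gt0 expn_gt0.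
have [muoo|muoo] := eqVneq (mu Q'.2) +oo%E.
  by rewrite muoo gt0_muley ?lte_fin// leey.
have [mu0|mu0] := eqVneq (mu Q'.2) 0%E.
  apply: ge_ereal_sup => /= _ [F [finF FP] <-].
  rewrite mu0 mule0 fsbig1// => Q /FP[[_ QQ'] [DQ _ _]].
  apply/eqP; rewrite -measure_le0 -mu0; apply: le_mu => //.
  - exact: (cube_borel DQ).
  - exact: (cube_borel DQ').
have mu_gt0 : (0 < mu Q'.2)%E by rewrite lt0e mu0 measure_ge0.
have mu_ltoo : (mu Q'.2 < +oo)%E by rewrite ltey.
have /choice[hole holeP] : forall Q, exists xi,
    porous_cubes D E M delta Q ->
    cball D M Q xi /\ ((delta * side Q)%:E <= edist_inf E xi)%E.
  move=> Q.
  have [[_ _ [xi Qxi xiE]]|nP] := pselect (porous_cubes D E M delta Q).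
    by exists xi.
  by exists point => /nP.
pose H Q : set (borel X) := sball S (hole Q) (delta / 2 * side Q).
apply: ge_ereal_sup => /= _ [F [finF FP] <-].
rewrite fsbig_finite//=.
have us := finmap.fset_uniq (fset_set F).
have sP : {in finmap.enum_fset (fset_set F), forall Q,
    subcube Q Q' /\ porous_cubes D E M delta Q}.
  by move=> Q; rewrite in_fset_set// inE => /FP.
move: (finmap.enum_fset (fset_set F)) us sP => s us sP.
apply: (@le_trans _ _ (\sum_(Q <- s) (C ^+ k1)%:E * mu (H Q))%E).
  rewrite !big_seq; apply: lee_sum => Q /sP[QQ' PQ].
  have [Qh _] := holeP Q PQ; have [DQ _ _] := PQ.
  exact: cube_le_hole.
rewrite -ge0_sume_distrr// /C1 !EFinM -!muleA lee_wpmul2l ?lee_fin ?exprn_ge0//.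
apply: (@le_trans _ _ ((W.+1 * 2 ^ N)%N%:R%:E *
    mu (sball S (ctr Q') ((2 * M + 5) * side Q')))%E); last first.
  by rewrite lee_wpmul2l ?lee_fin//; exact: dilated_cube_le.
apply: sum_measure_le_overlap.
- by move=> Q; exact: measurable_sball.
- exact: measurable_sball.
- move=> Q /sP[QQ' PQ]; have [Qh _] := holeP Q PQ; have [DQ _ _] := PQ.
  exact: hole_in_dilated_cube.
move=> x; rewrite -size_filter.
apply: (hole_overlap E delta W N k2 k3 hole _ x) => //.
- by rewrite filter_uniq.
- by move=> Q; rewrite mem_filter => /andP[_ /sP[QQ' []]].
- by move=> Q; rewrite mem_filter => /andP[_ /sP[_ /holeP]].
- by move=> Q; rewrite mem_filter => /andP[/asboolP].
Qed.

End fixed_cube.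
End porous_cubes.

Theorem corollary3p4 (R : realType) (c0 : R) (c0_gt0 : 0 < c0)
    (c0_lt : c0 < 1000%:R^-1)
    (M delta Cmu : R) (delta_gt0 : 0 < delta) (delta_lt1 : delta < 1)
    (M_gt1 : 1 < M) (Cmu_gt1 : 1 < Cmu) :
  exists C1 : R, 0 < C1 /\
    forall (X : pmetricType R) (mu : {measure set (borel X) -> \bar R})
      (D : cubes c0 (msupp mu)) (Q0 : cube X) (E : set X) (M0 : R),
      in_cubes D Q0 ->
      measurable (E : set (borel X)) ->
      E `<=` Q0.2 ->
      1 < M0 ->
      M < M0 / 2 ->
      (forall (xi : X) (r : R), cball D (4 * M0) Q0 xi ->
        0 < r -> r < 4 * M0 * cube_side c0 Q0 ->
        (mu (sball (msupp mu) xi (2 * r)) <=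
           Cmu%:E * mu (sball (msupp mu) xi r))%E) ->
      forall Q' : cube X, in_cubes D Q' -> subcube Q' Q0 ->
        ((\esum_(Q in [set Q | subcube Q Q' /\ porous_cubes D E M delta Q])
            mu Q.2)%R <= C1%:E * mu Q'.2)%E.
Proof.
have c0_le_half : c0 <= 2^-1.
  apply: le_trans (ltW c0_lt) _.
  by rewrite lef_pV2 ?posrE ?ltr0n// ler_nat.
have c0_le1 : c0 <= 1 by lra.
have C0 : 0 < Cmu by lra.
have ratio_gt0 : 0 < delta / (2 * (M + 2)) by rewrite divr_gt0//; lra.
have [W Wdelta] := exists_exp_small c0 _ c0_gt0 c0_le_half ratio_gt0.
have delta2 : 0 < delta / 2 by lra.
have [k1 k1M] := exists_pow2_ge (M + 1) _ delta2.
have cst1_gt0 : 0 < cst1 :> R by rewrite invr_gt0 ltr0n.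
have [k2 k2M] := exists_pow2_ge (2 * M + 5) _ cst1_gt0.
have cW : 0 < c0 ^+ W / 2 by rewrite divr_gt0 ?exprn_gt0.
have [k3 k3M] := exists_pow2_ge ((2 * M + 5) * 5) _ cW.
have /archi_boundP/ltW CN : 0 <= Cmu ^+ k3 by rewrite exprn_ge0 ?ltW.
exists (Cmu ^+ k1 * ((W.+1 * 2 ^ Num.bound (Cmu ^+ k3))%N%:R * Cmu ^+ k2)); split.
  by rewrite !mulr_gt0 ?exprn_gt0// ltr0n muln_gt0 expn_gt0.
move=> X mu D Q0 E M0 DQ0 _ _ _ MM0 dbl Q' DQ' QQ0.
have chain : doubling_chain D M Cmu Q'.
  exact: (doubling_chain_subcube c0_gt0 c0_le1 D M M0 Cmu Q0 Q' (ltW C0)).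
exact: (porous_sum_le c0_gt0 c0_le1 D (ltW C0) DQ' chain) CN.
Qed.
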